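(* Let $M=\varprojlim M_i$ be a projective limit of Banach manifolds, let $\nabla=\varprojlim\nabla_i$ be a connection on $M$, and define $Hf(X,Y):=X(Y(f))-(\nabla_XY)f$ for $f\in\mathcal F(M)$ and $X,Y\in\mathcal G(M)$. Then $H$ is a Hessian structure on $M$. Conversely, every connection $\nabla$ on $M$ obtained as a projective limit of connections arises from a Hessian structure, i.e. there is a Hessian structure $H$ on $M$ with $(\nabla_XY)f=X(Y(f))-Hf(X,Y)$ for all $f\in\mathcal F(M)$ and $X,Y\in\mathcal G(M)$.
   Context: Setting. $\{(M_i,\varphi_{ji})\}$ is a projective system of smooth Banach manifolds (with smooth connecting maps $\varphi_{ji}:M_j\to M_i$ for $j\ge i$), where $M_i$ is modelled on the Banach space $\mathbb E_i$ and $\{\mathbb E_i,\rho_{ji}\}$ is a projective system of Banach spaces with continuous linear maps $\rho_{ji}:\mathbb E_j\to\mathbb E_i$ and limit the Fréchet space $\mathbb F=\varprojlim\mathbb E_i$. Every $m=(m_i)\in M=\varprojlim M_i$ is assumed to have a projective system of charts $(U_i,\varphi_i)$ of $M_i$, $m_i\in U_i$, $\varphi_{ji}(U_j)\subseteq U_i$, $\varphi_i\circ\varphi_{ji}=\rho_{ji}\circ\varphi_j$ on $U_j$, such that $U=\varprojlim U_i$ is open in $M$ and $\varphi=\varprojlim\varphi_i$ maps $U$ onto an open subset of $\mathbb F$. Such $(U,\varphi)$ are the (projective limit) charts, which make $M$ a Fréchet manifold modelled on $\mathbb F$. $L^2(\mathbb E,\mathbb E)$ is the space of continuous bilinear maps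 $\mathbb E\times\mathbb E\to\mathbb E$, and $\mathcal H^2(\mathbb F,\mathbb F)$ is the Fréchet space of sequences $(B_i)\in\prod_iL^2(\mathbb E_i,\mathbb E_i)$ with $B_i\circ(\rho_{ji}\times\rho_{ji})=\rho_{ji}\circ B_j$ for $j\ge i$. $\mathcal F(M)$ is the set of functions $f=\varprojlim f_i$ with $f_i:M_i\to\mathbb R$ smooth and $f_j=f_i\circ\varphi_{ji}$; $\mathcal G(M)$ is the set of vector fields $X=\varprojlim X_i$ with $X_i$ a smooth vector field on $M_i$ and $T\varphi_{ji}\circ X_j=X_i\circ\varphi_{ji}$. $X_\varphi$, $f_\varphi=f\circ\varphi^{-1}$ denote local representatives. Connections. A connection on a Banach manifold $N$ modelled on $\mathbb E$ is a map $(X,Y)\mapsto\nabla_XY$ on smooth vector fields such that for every chart there is a smooth $\Gamma_\varphi:\varphi(U)\to L^2(\mathbb E,\mathbb E)$ with $(\nabla_XY)_\varphi(u)=DY_\varphi(u).X_\varphi(u)-\Gamma_\varphi(u)(X_\varphi(u),Y_\varphi(u))$. Connections $\nabla_i$ on $M_i$ form a projective system if in projective limit charts $\rho_{ji}\circ\Gamma_{\varphi_j}(u_j)=\Gamma_{\varphi_i}(\rho_{ji}u_j)\circ(\rho_{ji}\times\rho_{ji})$ for $j\ge i$; then $\nabla=\varprojlim\nabla_i$ is defined on $\mathcal G(M)$ by $\nabla_XY=\varprojlim(\nabla_i)_{X_i}Y_i$, and has local components $\Gamma_\varphi=\varprojlim\Gamma_{\varphi_i}:\varphi(U)\to\mathcal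 H^2(\mathbb F,\mathbb F)$. Hessian structure on $M$. A map $H:f\mapsto Hf$ assigning to every $f\in\mathcal F(M)$ a covariant 2-tensor $Hf$ on $M$ such that for every projective limit chart $(U,\varphi)$ there is a smooth map $\Gamma_\varphi=\varprojlim\Gamma_{\varphi_i}:\varphi(U)\to\mathcal H^2(\mathbb F,\mathbb F)$ with $[Hf(X,Y)]_\varphi(u)=D^2f_\varphi(u)(X_\varphi(u),Y_\varphi(u))+Df_\varphi(u).\Gamma_\varphi(u)(X_\varphi(u),Y_\varphi(u))$ for all $X,Y\in\mathcal G(M)$. *)

(* Defs.v *)
From HB Require Import structures.
From mathcomp Require Import all_boot all_order all_algebra.
From mathcomp Require Import all_classical all_reals all_analysis.

Set Implicit Arguments.
Unset Strict Implicit.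
Unset Printing Implicit Defensive.

Import Order.TTheory GRing.Theory Num.Theory.
Import numFieldTopology.Exports numFieldNormedType.Exports.

Local Open Scope classical_set_scope.
Local Open Scope ring_scope.

Record clin (R : realType) (V W : normedModType R) := Clin {
  clin_fun :> V -> W;
  clin_linear : linear clin_fun;
  clin_continuous : continuous clin_fun }.

Section ClinTheory.
Context {R : realType} {V W : normedModType R}.
Implicit Types f g : clin V W.

Lemma clinP f g : f =1 g -> f = g.
Proof.
case: f => f lf cf; case: g => g lg cg /= /funext fg; subst g.
by congr Clin; exact: Prop_irrelevance.
Qed.

HB.instance Definition _ f :=
  @GRing.isLinear.Build _ _ _ _ f (clin_linear f).

HB.instance Definition _ := gen_eqMixin (clin V W).
HB.instance Definition _ := gen_choiceMixin (clin V W).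

Lemma clin0_linear : linear (fun _ : V => 0 : W).
Proof. by move=> a x y; rewrite scaler0 addr0. Qed.

Lemma clinN_linear f : linear (fun x => - f x).
Proof. by move=> a x y; rewrite linearP opprD scalerN. Qed.

Lemma clinD_linear f g : linear (fun x => f x + g x).
Proof. by move=> a x y; rewrite !linearP scalerDr addrACA. Qed.

Lemma clinZ_linear (k : R) f : linear (fun x => k *: f x).
Proof. by move=> a x y; rewrite linearP scalerDr !scalerA mulrC. Qed.

Lemma clin0_continuous : continuous (fun _ : V => 0 : W).
Proof. by move=> x; exact: cvg_cst. Qed.

Lemma clinN_continuous f : continuous (fun x => - f x).
Proof. by move=> x; apply: cvgN; exact: clin_continuous. Qed.

Lemma clinD_continuous f g : continuous (fun x => f x + g x).
Proof. by move=> x; apply: cvgD; exact: clin_continuous. Qed.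

Lemma clinZ_continuous (k : R) f : continuous (fun x => k *: f x).
Proof. by move=> x; apply: cvgZr; exact: clin_continuous. Qed.

Definition clin0 := Clin clin0_linear clin0_continuous.
Definition clinN f := Clin (clinN_linear f) (@clinN_continuous f).
Definition clinD f g := Clin (clinD_linear f g) (@clinD_continuous f g).
Definition clinZ k f := Clin (clinZ_linear k f) (@clinZ_continuous k f).

Fact clinDA : associative clinD.
Proof. by move=> f g h; apply: clinP => x /=; rewrite addrA. Qed.
Fact clinDC : commutative clinD.
Proof. by move=> f g; apply: clinP => x /=; rewrite addrC. Qed.
Fact clin0D : left_id clin0 clinD.
Proof. by move=> f; apply: clinP => x /=; rewrite add0r. Qed.
Fact clinND : left_inverse clin0 clinN clinD.
Proof. by move=> f; apply: clinP => x /=; rewrite addNr. Qed.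

HB.instance Definition _ :=
  GRing.isZmodule.Build (clin V W) clinDA clinDC clin0D clinND.

Fact clinZA a b f : clinZ a (clinZ b f) = clinZ (a * b) f.
Proof. by apply: clinP => x /=; rewrite scalerA. Qed.
Fact clin1Z : left_id 1 clinZ.
Proof. by move=> f; apply: clinP => x /=; rewrite scale1r. Qed.
Fact clinZDr : right_distributive clinZ +%R.
Proof. by move=> a f g; apply: clinP => x /=; rewrite scalerDr. Qed.
Fact clinZDl f : {morph clinZ^~ f : a b / a + b}.
Proof. by move=> a b; apply: clinP => x /=; rewrite scalerDl. Qed.

HB.instance Definition _ :=
  GRing.Zmodule_isLmodule.Build R (clin V W) clinZA clin1Z clinZDr clinZDl.

Definition opnorm f : R := sup [set `|f x| | x in [set x : V | `|x| <= 1]].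

Lemma opnorm_has_sup f : has_sup [set `|f x| | x in [set x : V | `|x| <= 1]].
Proof.
split; first by exists `|f 0|; exists 0 => //=; rewrite normr0.
have /linear_bounded_continuous/bounded_funP/(_ 1)[M fM] := @clin_continuous _ _ _ f.
by exists M => _ [x /= x1 <-]; exact: fM.
Qed.

Lemma opnorm_ge0 f : 0 <= opnorm f.
Proof.
apply: le_trans (ub_le_sup (proj2 (opnorm_has_sup f)) _); last first.
  by exists 0; [rewrite /= normr0|reflexivity].
by rewrite normr_ge0.
Qed.

Lemma opnormP f x : `|f x| <= opnorm f * `|x|.
Proof.
have [->|x0] := eqVneq x 0; first by rewrite linear0 !normr0 mulr0.
have nx : 0 < `|x| by rewrite normr_gt0.
rewrite -ler_pdivrMr// mulrC.
have -> : `|x|^-1 * `|f x| = `|f (`|x|^-1 *: x)|.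
  by rewrite linearZ normrZ ger0_norm// invr_ge0.
apply: (ub_le_sup (proj2 (opnorm_has_sup f))).
by exists (`|x|^-1 *: x) => //=; rewrite normrZ ger0_norm ?invr_ge0// mulVf ?gt_eqF.
Qed.

Lemma opnorm_le f (k : R) : (forall x, `|x| <= 1 -> `|f x| <= k) -> opnorm f <= k.
Proof.
move=> fk; apply: ge_sup; first by have [] := opnorm_has_sup f.
by move=> _ [x /= x1 <-]; exact: fk.
Qed.

Lemma opnorm_bound f x : `|x| <= 1 -> `|f x| <= opnorm f.
Proof.
by move=> x1; rewrite (le_trans (opnormP f x))// ler_piMr ?opnorm_ge0.
Qed.

Fact opnormD f g : opnorm (f + g) <= opnorm f + opnorm g.
Proof.
apply: opnorm_le => x x1.
by rewrite (le_trans (ler_normD _ _))// lerD// opnorm_bound.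
Qed.

Fact opnormZ (l : R) f : opnorm (l *: f) = `|l| * opnorm f.
Proof.
have le k h : opnorm (k *: h) <= `|k| * opnorm h.
  apply: opnorm_le => x x1; rewrite [X in `|X|](_ : _ = k *: h x)//.
  by rewrite normrZ ler_wpM2l// opnorm_bound.
apply/eqP; rewrite eq_le le/=.
have [->|l0] := eqVneq l 0; first by rewrite normr0 mul0r opnorm_ge0.
rewrite -ler_pdivlMl ?normr_gt0// -normfV.
by rewrite -{1}[f]scale1r -(mulVf l0) -scalerA; exact: le.
Qed.

Fact opnorm_eq0 f : opnorm f = 0 -> f = 0.
Proof.
move=> f0; apply: clinP => x; apply/eqP; rewrite -normr_le0.
by rewrite (le_trans (opnormP f x))// f0 mul0r.
Qed.

HB.instance Definition _ :=
  Lmodule_isNormed.Build R (clin V W) opnormD opnormZ opnorm_eq0.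

End ClinTheory.

(* Continuous bilinear maps V * V -> W, through the canonical isometry
   L^2(V, W) = L(V, L(V, W)): B x y is the value of B at the pair (x, y). *)
Notation bilin V W := (clin V (clin V W)).

(* Frechet C^n maps between normed spaces: the differential is a C^(n-1) map
   into the normed space of continuous linear maps. *)
Fixpoint Cn (R : realType) (V : normedModType R) (n : nat) :
    forall W : normedModType R, set V -> (V -> W) -> Prop :=
  fun W U f =>
  match n with
  | 0%N => forall x, U x -> {for x, continuous f}
  | n'.+1 => exists df : V -> clin V W,
      (forall x, U x -> is_diff x f (df x)) /\ Cn n' U df
  end.

Definition smooth_on (R : realType) (V W : normedModType R) (U : set V)
  (f : V -> W) := forall n, Cn n U f.

HB.instance Definition _ (R : realType) (V W : preTopologicalLmodType R) :=
  Topological.on (V * W)%type.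

(* C^n maps between arbitrary (e.g. Frechet) topological vector spaces: the
   directional derivatives exist and define a C^(n-1) map of point and
   direction. *)
Fixpoint Cn_dir (R : realType) (W : preTopologicalLmodType R) (n : nat) :
    forall V : preTopologicalLmodType R, set V -> (V -> W) -> Prop :=
  fun V U f =>
  match n with
  | 0%N => forall x, U x -> {for x, continuous f}
  | n'.+1 => exists df : V * V -> W,
      (forall x v, U x ->
         (fun h : R => h^-1 *: (f (x + h *: v) - f x)) @ 0^' --> df (x, v)) /\
      @Cn_dir R W n' (V * V)%type (U `*` setT) df
  end.

Definition smooth_dir_on (R : realType) (V W : preTopologicalLmodType R)
  (U : set V) (f : V -> W) := forall n, Cn_dir n U f.

Definition ddir (R : realType) (V : preTopologicalLmodType R) (f : V -> R)
    (u v : V) : R :=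
  lim ((fun h : R => h^-1 * (f (u + h *: v) - f u)) @ 0^').

(* D^2 f(u)(x, y) *)
Definition ddir2 (R : realType) (V : preTopologicalLmodType R) (f : V -> R)
    (u x y : V) : R :=
  ddir (fun w => ddir f w y) u x.

(* The values of [ch_map] outside [ch_dom], and of [ch_inv] outside the image
   of [ch_dom], are irrelevant. *)
Record chart (R : realType) (T : topologicalType) (E : normedModType R) := Chart {
  ch_dom : set T;
  ch_map :> T -> E;
  ch_inv : E -> T;
  ch_dom_open : open ch_dom;
  ch_img_open : open (ch_map @` ch_dom);
  ch_mapK : forall p, ch_dom p -> ch_inv (ch_map p) = p;
  ch_map_continuous : forall p, ch_dom p -> {for p, continuous ch_map};
  ch_inv_continuous :
    forall u, (ch_map @` ch_dom) u -> {for u, continuous ch_inv} }.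

Definition ch_img (R : realType) (T : topologicalType) (E : normedModType R)
  (c : chart T E) : set E := c @` ch_dom c.

Definition chart_compat (R : realType) (T : topologicalType)
    (E : normedModType R) (c d : chart T E) : Prop :=
  smooth_on (c @` (ch_dom c `&` ch_dom d)) (d \o ch_inv c) /\
  smooth_on (d @` (ch_dom c `&` ch_dom d)) (c \o ch_inv d).

Record bmanifold (R : realType) (E : completeNormedModType R) := BManifold {
  bm_carrier :> topologicalType;
  atlas : set (chart bm_carrier E);
  atlas_cover : forall p, exists2 c, atlas c & ch_dom c p;
  atlas_compat : forall c d, atlas c -> atlas d -> chart_compat c d;
  atlas_max : forall c, (forall d, atlas d -> chart_compat c d) -> atlas c }.

Section BanachManifold.
Context {R : realType} {E : completeNormedModType R}.
Implicit Type N : bmanifold E.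

Definition smooth_fun N (f : N -> R) : Prop :=
  forall c, atlas c -> smooth_on (ch_img c) (f \o ch_inv c : E -> R^o).

(* A tangent vector at p, i.e. a class of triples (U, c, v), is given by all
   its representatives: [tv c] is the representative in the chart c. *)
Record tangent N (p : N) := Tangent {
  tv : chart N E -> E;
  tv_change : forall c d, atlas c -> atlas d -> ch_dom c p -> ch_dom d p ->
    tv d = 'd (d \o ch_inv c) (c p) (tv c);
  tv_out : forall c, ~ (atlas c /\ ch_dom c p) -> tv c = 0 }.

Definition vfield N := forall p : N, tangent p.

Definition vf_rep N (c : chart N E) (X : vfield N) : E -> E :=
  fun u => tv (X (ch_inv c u)) c.

Definition smooth_vfield N (X : vfield N) : Prop :=
  forall c, atlas c -> smooth_on (ch_img c) (vf_rep c X).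

Definition conn_component N (nabla : vfield N -> vfield N -> vfield N)
    (c : chart N E) (Gamma : E -> bilin E E) : Prop :=
  smooth_on (ch_img c) Gamma /\
  forall X Y, smooth_vfield X -> smooth_vfield Y -> forall u, ch_img c u ->
    vf_rep c (nabla X Y) u =
      'd (vf_rep c Y) u (vf_rep c X u) - Gamma u (vf_rep c X u) (vf_rep c Y u).

Definition is_connection N (nabla : vfield N -> vfield N -> vfield N) : Prop :=
  (forall X Y, smooth_vfield X -> smooth_vfield Y -> smooth_vfield (nabla X Y)) /\
  forall c, atlas c -> exists Gamma, conn_component nabla c Gamma.

End BanachManifold.

Section BanachManifoldMaps.
Context {R : realType} {E E' : completeNormedModType R}.
Variables (N : bmanifold E) (N' : bmanifold E').

Definition smooth_map (f : N -> N') : Prop :=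
  continuous f /\
  forall c d, atlas c -> atlas d ->
    smooth_on (c @` (ch_dom c `&` f @^-1` ch_dom d)) (d \o f \o ch_inv c).

(* T f (v) = w, for v tangent at p and w tangent at q = f p; q is kept separate
   so that points which are only provably equal to f p can be used. *)
Definition is_tangent_image (f : N -> N') (p : N) (q : N') (v : tangent p)
    (w : tangent q) : Prop :=
  f p = q /\
  forall c d, atlas c -> atlas d -> ch_dom c p -> ch_dom d q ->
    tv w d = 'd (d \o f \o ch_inv c) (c p) (tv v c).

End BanachManifoldMaps.

Record lsubprod (R : realType) (V : nat -> normedModType R) := LSubprod {
  lsp_set : set (forall i, V i);
  lsp0 : lsp_set (fun i => 0);
  lspP : forall (a : R) x y, lsp_set x -> lsp_set y ->
    lsp_set (fun i => a *: x i + y i) }.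

(* The elements of the subspace, with the topology induced by the product. *)
Record lsp (R : realType) (V : nat -> normedModType R) (S : lsubprod V) := Lsp {
  lsp_val :> forall i, V i;
  lsp_valP : lsp_set S lsp_val }.

Section LspTheory.
Context {R : realType} {V : nat -> normedModType R} {S : lsubprod V}.
Implicit Types x y : lsp S.

Lemma lsp_ext x y : (forall i, x i = y i) -> x = y.
Proof.
case: x y => [x Sx] [y Sy] /= xy.
have {}xy : x = y by apply: functional_extensionality_dep.
by subst y; congr Lsp; exact: Prop_irrelevance.
Qed.

HB.instance Definition _ := gen_eqMixin (lsp S).
HB.instance Definition _ := gen_choiceMixin (lsp S).
HB.instance Definition _ := Topological.copy (lsp S)
  (initial_topology (@lsp_val R V S : lsp S -> prod_topology V)).

Lemma lspZ_subproof (a : R) x : lsp_set S (fun i => a *: x i).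
Proof.
have := lspP a (lsp_valP x) (lsp0 S).
by congr (lsp_set _ _); apply: functional_extensionality_dep => i; rewrite addr0.
Qed.

Lemma lspD_subproof x y : lsp_set S (fun i => x i + y i).
Proof.
have := lspP 1 (lsp_valP x) (lsp_valP y).
by congr (lsp_set _ _); apply: functional_extensionality_dep => i; rewrite scale1r.
Qed.

Lemma lspN_subproof x : lsp_set S (fun i => - x i).
Proof.
have := lspZ_subproof (- 1) x.
by congr (lsp_set _ _); apply: functional_extensionality_dep => i; rewrite scaleN1r.
Qed.

Definition lsp_zero : lsp S := Lsp (lsp0 S).
Definition lsp_opp x : lsp S := Lsp (lspN_subproof x).
Definition lsp_add x y : lsp S := Lsp (lspD_subproof x y).
Definition lsp_scale (a : R) x : lsp S := Lsp (lspZ_subproof a x).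

Fact lsp_addA : associative lsp_add.
Proof. by move=> x y z; apply: lsp_ext => i /=; rewrite addrA. Qed.
Fact lsp_addC : commutative lsp_add.
Proof. by move=> x y; apply: lsp_ext => i /=; rewrite addrC. Qed.
Fact lsp_add0 : left_id lsp_zero lsp_add.
Proof. by move=> x; apply: lsp_ext => i /=; rewrite add0r. Qed.
Fact lsp_addN : left_inverse lsp_zero lsp_opp lsp_add.
Proof. by move=> x; apply: lsp_ext => i /=; rewrite addNr. Qed.

HB.instance Definition _ :=
  GRing.isZmodule.Build (lsp S) lsp_addA lsp_addC lsp_add0 lsp_addN.

Fact lsp_scaleA a b x : lsp_scale a (lsp_scale b x) = lsp_scale (a * b) x.
Proof. by apply: lsp_ext => i /=; rewrite scalerA. Qed.
Fact lsp_scale1 : left_id 1 lsp_scale.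
Proof. by move=> x; apply: lsp_ext => i /=; rewrite scale1r. Qed.
Fact lsp_scaleDr : right_distributive lsp_scale +%R.
Proof. by move=> a x y; apply: lsp_ext => i /=; rewrite scalerDr. Qed.
Fact lsp_scaleDl x : {morph lsp_scale^~ x : a b / a + b}.
Proof. by move=> a b; apply: lsp_ext => i /=; rewrite scalerDl. Qed.

HB.instance Definition _ := GRing.Zmodule_isLmodule.Build R (lsp S)
  lsp_scaleA lsp_scale1 lsp_scaleDr lsp_scaleDl.

End LspTheory.

Record bansys (R : realType) := Bansys {
  bs_space :> nat -> completeNormedModType R;
  rho : forall i j, (i <= j)%N -> clin (bs_space j) (bs_space i);
  rho_id : forall i (h : (i <= i)%N) x, rho h x = x;
  rho_comp : forall i j k (hij : (i <= j)%N) (hjk : (j <= k)%N) (hik : (i <= k)%N) x,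
    rho hij (rho hjk x) = rho hik x }.

Section FrechetLimit.
Context {R : realType} (B : bansys R).

Definition flim_set : set (forall i, B i) :=
  [set x | forall i j (h : (i <= j)%N), rho B h (x j) = x i].

Fact flim_set0 : flim_set (fun i => 0).
Proof. by move=> i j h; rewrite linear0. Qed.

Fact flim_setP (a : R) x y : flim_set x -> flim_set y ->
  flim_set (fun i => a *: x i + y i).
Proof. move=> hx hy i j h; by rewrite linearP /= hx hy. Qed.

Definition flim_lsub : lsubprod (fun i => B i) := LSubprod flim_set0 flim_setP.

(* F = lim E_i *)
Definition flim := lsp flim_lsub.

Definition hlim_set : set (forall i, bilin (B i) (B i)) :=
  [set b : forall i, bilin (B i) (B i) | forall i j (h : (i <= j)%N) x y,
     b i (rho B h x) (rho B h y) = rho B h (b j x y)].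

Fact hlim_set0 : hlim_set (fun i => 0).
Proof. by move=> i j h x y; rewrite linear0. Qed.

Fact hlim_setP (a : R) b b' : hlim_set b -> hlim_set b' ->
  hlim_set (fun i => a *: b i + b' i).
Proof. by move=> hb hb' i j h x y; rewrite linearP /= -hb -hb'. Qed.

Definition hlim_lsub : lsubprod (fun i => bilin (B i) (B i)) :=
  LSubprod hlim_set0 hlim_setP.

(* H^2(F, F) *)
Definition hlim := lsp hlim_lsub.

Fact hlim_app_subproof (b : hlim) (x y : flim) :
  lsp_set flim_lsub (fun i => b i (x i) (y i)).
Proof.
move=> i j h; rewrite -(lsp_valP b).
by rewrite (lsp_valP x) (lsp_valP y).
Qed.

Definition hlim_app (b : hlim) (x y : flim) : flim := Lsp (hlim_app_subproof b x y).

End FrechetLimit.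

HB.instance Definition _ (R : realType) (B : bansys R) :=
  PreTopologicalLmodule.on (flim B).
HB.instance Definition _ (R : realType) (B : bansys R) :=
  PreTopologicalLmodule.on (hlim B).

Record mansys (R : realType) (B : bansys R) := Mansys {
  ms_mfd :> forall i, bmanifold (B i);
  phi : forall i j, (i <= j)%N -> ms_mfd j -> ms_mfd i;
  phi_smooth : forall i j (h : (i <= j)%N), smooth_map (@phi i j h);
  phi_id : forall i (h : (i <= i)%N) p, phi h p = p;
  phi_comp : forall i j k (hij : (i <= j)%N) (hjk : (j <= k)%N) (hik : (i <= k)%N) p,
    phi hij (phi hjk p) = phi hik p }.

Record mlim (R : realType) (B : bansys R) (N : mansys B) := Mlim {
  mlim_val :> forall i, N i;
  mlim_valP : forall i j (h : (i <= j)%N), phi h (mlim_val j) = mlim_val i }.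

Section MlimTopology.
Context {R : realType} {B : bansys R} (N : mansys B).
HB.instance Definition _ := gen_eqMixin (mlim N).
HB.instance Definition _ := gen_choiceMixin (mlim N).
HB.instance Definition _ := Topological.copy (mlim N)
  (initial_topology (@mlim_val R B N : mlim N -> prod_topology (fun i => N i))).
End MlimTopology.

Definition lim_dom (R : realType) (B : bansys R) (N : mansys B)
    (c : forall i, chart (N i) (B i)) : set (mlim N) :=
  [set m | forall i, ch_dom (c i) (m i)].

(* Projective limit charts; [pc_map] is the limit of the c_i, and [pc_inv] its
   inverse. Their values outside the domain, resp. the image, are irrelevant. *)
Record pchart (R : realType) (B : bansys R) (N : mansys B) := Pchart {
  pc_chart :> forall i, chart (N i) (B i);
  pc_map : mlim N -> flim B;
  pc_inv : flim B -> mlim N;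
  pc_atlas : forall i, atlas (pc_chart i);
  pc_sub : forall i j (h : (i <= j)%N),
    phi h @` ch_dom (pc_chart j) `<=` ch_dom (pc_chart i);
  pc_rho : forall i j (h : (i <= j)%N) p, ch_dom (pc_chart j) p ->
    pc_chart i (phi h p) = rho B h (pc_chart j p);
  pc_mapE : forall m, lim_dom pc_chart m -> forall i, pc_map m i = pc_chart i (m i);
  pc_mapK : forall m, lim_dom pc_chart m -> pc_inv (pc_map m) = m;
  pc_dom_open : open (lim_dom pc_chart);
  pc_img_open : open (pc_map @` lim_dom pc_chart) }.

Definition pc_dom (R : realType) (B : bansys R) (N : mansys B) (c : pchart N) :=
  lim_dom c.

Definition pc_img (R : realType) (B : bansys R) (N : mansys B) (c : pchart N) :
  set (flim B) := pc_map c @` pc_dom c.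

Record plmanifold (R : realType) (B : bansys R) := PLManifold {
  pl_sys :> mansys B;
  pl_cover : forall m : mlim pl_sys, exists c : pchart pl_sys, pc_dom c m }.

(* T_m M = lim T_(m_i) M_i *)
Record ltangent (R : realType) (B : bansys R) (N : mansys B) (m : mlim N) :=
  LTangent {
  lt_val :> forall i, tangent (m i);
  lt_valP : forall i j (h : (i <= j)%N),
    is_tangent_image (@phi R B N i j h) (lt_val j) (lt_val i) }.

Section TangentCoordinates.
Context {R : realType} {B : bansys R} {N : mansys B}.

Lemma diff_locally_clin (V W : normedModType R) (f : V -> W) (l : clin V W) (x : V) :
  (\forall y \near x, f y = l y) -> 'd f x = l :> (V -> W).
Proof.
move=> fl; apply: diff_unique; first exact: clin_continuous.
apply/eqaddoP => _/posnumP[e].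
have fx : f x = l x by exact: nbhs_singleton fl.
move: fl; rewrite (near_shift 0) subr0; apply: filterS => y /= fly.
rewrite !fctE /= fly fx linearD [l y + _]addrC subrr normr0.
by rewrite mulr_ge0.
Qed.

Lemma pc_coord_subproof (c : pchart N) (m : mlim N) (v : ltangent m) :
  pc_dom c m -> lsp_set (flim_lsub B) (fun i => tv (v i) (c i)).
Proof.
move=> cm i j h; have [_ /(_ _ _ (pc_atlas c j) (pc_atlas c i) (cm j) (cm i))] :=
  lt_valP v h.
have ci : \forall y \near c j (m j),
    (c i \o phi h \o ch_inv (c j)) y = rho B h y.
  have cj : nbhs (c j (m j)) (ch_img (c j)).
    by apply: open_nbhs_nbhs; split; [exact: ch_img_open|exists (m j)].
  by apply: filterS cj => _ [p cp <-] /=; rewrite ch_mapK// pc_rho.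
by rewrite (diff_locally_clin ci) => ->.
Qed.

(* The coordinate (tv (v i) (c i))_i in F of a tangent vector v at m, which is
   only meaningful for m in the domain of c. *)
Definition pc_coord (c : pchart N) (m : mlim N) (v : ltangent m) : flim B :=
  match pselect (pc_dom c m) with
  | left cm => Lsp (pc_coord_subproof v cm)
  | right _ => 0
  end.

End TangentCoordinates.

Section LimitGeometry.
Context {R : realType} {B : bansys R} (M : plmanifold B).

Definition lvfield := forall m : mlim M, ltangent m.

Definition pc_rep (c : pchart M) (X : lvfield) : flim B -> flim B :=
  fun u => pc_coord c (X (pc_inv c u)).

Definition chart_at (m : mlim M) : pchart M := projT1 (cid (pl_cover m)).

(* The derivative of g along X, computed at m in some chart around m. *)
Definition lie (X : lvfield) (g : mlim M -> R) : mlim M -> R :=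
  fun m => let c := chart_at m in
    ddir (g \o pc_inv c) (pc_map c m) (pc_coord c (X m)).

Definition fun_thread (f_ : forall i, M i -> R) : Prop :=
  (forall i, smooth_fun (f_ i)) /\
  (forall i j (h : (i <= j)%N) p, f_ j p = f_ i (phi h p)).

Definition is_fun_lim (f : mlim M -> R) (f_ : forall i, M i -> R) : Prop :=
  forall m i, f m = f_ i (m i).

Definition FM : set (mlim M -> R) :=
  [set f | exists2 f_, fun_thread f_ & is_fun_lim f f_].

Definition vf_thread (X_ : forall i, vfield (M i)) : Prop :=
  (forall i, smooth_vfield (X_ i)) /\
  (forall i j (h : (i <= j)%N) p,
     is_tangent_image (@phi R B M i j h) (X_ j p) (X_ i (phi h p))).

Definition is_vf_lim (X : lvfield) (X_ : forall i, vfield (M i)) : Prop :=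
  forall m i, X m i = X_ i (m i).

Definition GM : set lvfield :=
  [set X | exists2 X_, vf_thread X_ & is_vf_lim X X_].

Definition gamma_thread (c : pchart M)
    (Gamma_ : forall i, B i -> bilin (B i) (B i)) : Prop :=
  forall i j (h : (i <= j)%N) u, ch_img (c j) u -> forall x y,
    rho B h (Gamma_ j u x y) = Gamma_ i (rho B h u) (rho B h x) (rho B h y).

(* [conn_component] does not determine the components when there are few global
   vector fields; the compatibility is that of some choice of components. *)
Definition conn_system
    (nabla_ : forall i, vfield (M i) -> vfield (M i) -> vfield (M i)) : Prop :=
  (forall i, is_connection (nabla_ i)) /\
  forall c : pchart M, exists Gamma_ : forall i, B i -> bilin (B i) (B i),
    (forall i, conn_component (nabla_ i) (c i) (Gamma_ i)) /\
    gamma_thread c Gamma_.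

Definition is_conn_lim (nabla : lvfield -> lvfield -> lvfield)
    (nabla_ : forall i, vfield (M i) -> vfield (M i) -> vfield (M i)) : Prop :=
  (forall X Y, GM X -> GM Y -> GM (nabla X Y)) /\
  forall X Y X_ Y_, vf_thread X_ -> is_vf_lim X X_ ->
    vf_thread Y_ -> is_vf_lim Y Y_ ->
    is_vf_lim (nabla X Y) (fun i => nabla_ i (X_ i) (Y_ i)).

(* Z = a X + b Y, for functions a and b *)
Definition is_lincomb (a b : mlim M -> R) (X Y Z : lvfield) : Prop :=
  forall m i c, tv (Z m i) c = a m *: tv (X m i) c + b m *: tv (Y m i) c.

(* F(M)-bilinear maps G(M) * G(M) -> F(M) *)
Definition is_tensor2 (T : lvfield -> lvfield -> mlim M -> R) : Prop :=
  (forall X Y, GM X -> GM Y -> FM (T X Y)) /\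
  forall a b X Y Z W, FM a -> FM b -> GM X -> GM Y -> GM Z -> GM W ->
    is_lincomb a b X Y Z -> forall m,
      T Z W m = a m * T X W m + b m * T Y W m /\
      T W Z m = a m * T W X m + b m * T W Y m.

(* [H], like [nabla] above, is only relevant on F(M), resp. G(M). *)
Definition is_hessian
    (H : (mlim M -> R) -> lvfield -> lvfield -> mlim M -> R) : Prop :=
  (forall f, FM f -> is_tensor2 (H f)) /\
  forall c : pchart M,
    exists (Gamma_ : forall i, B i -> bilin (B i) (B i)) (Gamma : flim B -> hlim B),
    [/\ forall i, smooth_on (ch_img (c i)) (Gamma_ i),
        gamma_thread c Gamma_,
        forall u, pc_img c u -> forall i, Gamma u i = Gamma_ i (u i),
        smooth_dir_on (pc_img c) Gamma &
        forall f X Y, FM f -> GM X -> GM Y -> forall u, pc_img c u ->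
          H f X Y (pc_inv c u) =
            ddir2 (f \o pc_inv c) u (pc_rep c X u) (pc_rep c Y u) +
            ddir (f \o pc_inv c) u
              (hlim_app (Gamma u) (pc_rep c X u) (pc_rep c Y u))].

End LimitGeometry.

(* Main.v *)
From HB Require Import structures.
Require Import Defs.
From mathcomp Require Import all_boot all_order all_algebra.
From mathcomp Require Import all_classical all_reals all_analysis.

Set Implicit Arguments.
Unset Strict Implicit.
Unset Printing Implicit Defensive.

Import Order.TTheory GRing.Theory Num.Theory.
Import numFieldTopology.Exports numFieldNormedType.Exports.

Local Open Scope classical_set_scope.
Local Open Scope ring_scope.

(** In a chart, the product rule gives X(Y(f)) = D^2 f(X, Y) + Df.(DY.X), and the
    local form of the connection gives (nabla_X Y)f = Df.(DY.X) - Df.Gamma(X, Y).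
    In the difference the derivative of Y cancels, which leaves
    exactly D^2 f(X, Y) + Df.Gamma(X, Y): this is the local form of a Hessian
    structure, with the components Gamma of the connection, and it depends on X
    and Y only through their values at m, bilinearly. The converse solves the
    definition of H for (nabla_X Y)f.

    The passage to the limit rests on the fact that a function of F(M) is a
    thread, so that it factors through every M_i. The derivative of a function
    that factors through one coordinate u_i of F is a derivative in the Banach
    space E_i (ddir_cylinder), hence the Lie derivative of f along X on M is the
    thread of the Lie derivatives X_i(f_i) on the M_i (lieE). These are
    independent of charts and compatible with the connecting maps for one and the
    same reason, the chain rule (diff_tangent_image). The cancellation can
    therefore be carried out on a single M_i (vf_deriv_commutator).

    What belongs to the limit itself is the smoothness of Gamma as a map from an
    open set of F to H^2(F, F). Its directional derivatives are computed
    component by component; they stay in H^2(F, F) because that space is closed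
    (hlim_closed), and they are again limits of smooth maps between Banach spaces,
    so that an induction on the order applies (limit_Cn_dir). *)

(** * Continuous linear and bilinear maps *)

Section OperatorToolbox.
Context {R : realType}.

Lemma clinDE (V W : normedModType R) (A A' : clin V W) x : (A + A') x = A x + A' x.
Proof. by []. Qed.

Lemma clinNE (V W : normedModType R) (A : clin V W) x : (- A) x = - A x.
Proof. by []. Qed.

Lemma clinZE (V W : normedModType R) (k : R) (A : clin V W) x :
  (k *: A) x = k *: A x.
Proof. by []. Qed.

Lemma clin_normP (V W : normedModType R) (A : clin V W) x :
  `|A x| <= `|A| * `|x|.
Proof. exact: opnormP. Qed.

Lemma clin_norm_le (V W : normedModType R) (A : clin V W) (k : R) : 0 <= k ->
  (forall x, `|A x| <= k * `|x|) -> `|A| <= k.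
Proof.
move=> k0 Ak; apply: opnorm_le => x x1.
by rewrite (le_trans (Ak x))// ler_piMr.
Qed.

Lemma linear_bound_continuous (V W : normedModType R) (f : V -> W) (k : R) :
  linear f -> (forall x, `|f x| <= k * `|x|) -> continuous f.
Proof.
move=> lf fk.
pose fM := GRing.isLinear.Build _ _ _ _ f lf.
pose fL : {linear V -> W} := HB.pack f fM.
rewrite -[f]/(fL : V -> W).
apply/linear_bounded_continuous/bounded_funP => r.
exists (`|k| * `|r|) => x xr; apply: le_trans (fk x) _.
apply: (@le_trans _ _ (`|k| * `|x|)).
  by rewrite ler_wpM2r// ler_norm.
by rewrite ler_wpM2l// (le_trans xr)// ler_norm.
Qed.

Definition mk_clin (V W : normedModType R) (f : V -> W) (k : R) (lf : linear f)
  (fk : forall x, `|f x| <= k * `|x|) : clin V W :=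
  Clin lf (linear_bound_continuous lf fk).

Section Bilinear.
Context {V W Z : normedModType R} (f : V -> W -> Z) (k : R).
Hypothesis k0 : 0 <= k.
Hypothesis fl : forall y, linear (f^~ y).
Hypothesis fr : forall x, linear (f x).
Hypothesis fk : forall x y, `|f x y| <= k * `|x| * `|y|.

Definition mk_bilin_row x : clin W Z := mk_clin (fr x) (fk x).

Lemma mk_bilin_linear : linear mk_bilin_row.
Proof. by move=> a x y; apply: clinP => z /=; rewrite fl. Qed.

Lemma mk_bilin_bound x : `|mk_bilin_row x| <= k * `|x|.
Proof. by apply: clin_norm_le => [|y]; [rewrite mulr_ge0|exact: fk]. Qed.

Definition mk_bilin : clin V (clin W Z) := mk_clin mk_bilin_linear mk_bilin_bound.

End Bilinear.

Section Flip.
Context {V W Z : normedModType R} (b : clin V (clin W Z)).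

Lemma clin_bilin_normP x y : `|b x y| <= `|b| * `|x| * `|y|.
Proof.
apply: le_trans (clin_normP _ _) _.
by rewrite ler_wpM2r// clin_normP.
Qed.

Lemma flip_linear_l x : linear (fun y => b y x).
Proof. by move=> a y z; rewrite linearP. Qed.

Lemma flip_linear_r y : linear (fun x => b y x).
Proof. by move=> a x z; rewrite linearP. Qed.

Lemma flip_bound y x : `|b x y| <= `|b| * `|y| * `|x|.
Proof. by rewrite mulrAC clin_bilin_normP. Qed.

Definition clin_flip : clin W (clin V Z) :=
  mk_bilin (normr_ge0 b) flip_linear_r flip_linear_l flip_bound.

End Flip.

Section Composition.
Context {V W Z : normedModType R}.

Lemma comp_linear (A : clin W Z) (C : clin V W) : linear (A \o C).
Proof. by move=> a x y /=; rewrite !linearP. Qed.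

Lemma comp_bound (A : clin W Z) (C : clin V W) x :
  `|A (C x)| <= (`|A| * `|C|) * `|x|.
Proof.
apply: le_trans (clin_normP _ _) _.
by rewrite -mulrA ler_wpM2l// clin_normP.
Qed.

Definition clin_comp (A : clin W Z) (C : clin V W) : clin V Z :=
  mk_clin (comp_linear A C) (comp_bound A C).

Lemma clin_comp_linear_l C : linear (clin_comp^~ C).
Proof. by move=> a A A'; apply: clinP. Qed.

Lemma clin_comp_linear_r A : linear (clin_comp A).
Proof. by move=> a C C'; apply: clinP => x /=; rewrite linearP. Qed.

Lemma clin_comp_bound A C : `|clin_comp A C| <= 1 * `|A| * `|C|.
Proof.
rewrite mul1r; apply: clin_norm_le => [|x]; first by rewrite mulr_ge0.
exact: comp_bound.
Qed.

Definition clin_compb : clin (clin W Z) (clin (clin V W) (clin V Z)) :=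
  mk_bilin ler01 clin_comp_linear_l clin_comp_linear_r clin_comp_bound.
End Composition.

Lemma clin_id_bound (V : normedModType R) (x : V) : `|id x| <= 1 * `|x|.
Proof. by rewrite mul1r. Qed.

Lemma clin_id_linear (V : normedModType R) : linear (@id V).
Proof. by []. Qed.

Definition clin_id (V : normedModType R) : clin V V :=
  mk_clin (@clin_id_linear V) (@clin_id_bound V).

Section Projections.
Context {V W : normedModType R}.

Lemma fst_linear : linear (@fst V W). Proof. by []. Qed.
Lemma snd_linear : linear (@snd V W). Proof. by []. Qed.

Lemma fst_bound (x : V * W) : `|x.1| <= 1 * `|x|.
Proof. by rewrite mul1r /Num.norm/= le_max lexx. Qed.

Lemma snd_bound (x : V * W) : `|x.2| <= 1 * `|x|.
Proof. by rewrite mul1r /Num.norm/= le_max lexx orbT. Qed.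

Definition clin_fst : clin (V * W)%type V := mk_clin fst_linear fst_bound.
Definition clin_snd : clin (V * W)%type W := mk_clin snd_linear snd_bound.
End Projections.

(** Evaluation is jointly continuous for the operator norm: write
    A t (x t) as (A t - A0) (x t) + A0 (x t) and bound the first term by
    the product of the norms. *)
Lemma clin_app_cvg (V W : normedModType R) (T : Type) (F : set_system T)
    (A : T -> clin V W) (x : T -> V) (A0 : clin V W) (x0 : V) : Filter F ->
  A @ F --> A0 -> x @ F --> x0 -> (fun t => A t (x t)) @ F --> A0 x0.
Proof.
move=> FF AA0 xx0.
have E : (fun t => A t (x t)) = (fun t => (A t - A0) (x t) + A0 (x t)).
  by apply/funext => t; rewrite clinDE clinNE subrK.
rewrite E -[A0 x0]add0r; apply: cvgD; last first.
  by apply: (@cvg_comp _ _ _ x A0 F _ _ xx0); exact: clin_continuous.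
apply: norm_cvg0.
apply: (@squeeze_cvgr _ _ _ _ (cst 0) (fun t => `|A t - A0| * `|x t|)).
- by apply: nearW => t; rewrite normr_ge0 clin_normP.
- exact: cvg_cst.
- rewrite -(mul0r `|x0|); apply: cvgM; last exact: cvg_norm.
  rewrite -(@normr0 _ (clin V W)) -(subrr A0); apply: cvg_norm.
  by apply: cvgB => //; exact: cvg_cst.
Qed.

End OperatorToolbox.

(** * Calculus of C^n maps between normed spaces *)

Section LocalDiff.
Context {R : realType} {V W : normedModType R}.

Lemma near_eq_is_diff (f g : V -> W) (df : V -> W) (x : V) :
  (\forall y \near x, f y = g y) -> is_diff x f df -> is_diff x g df.
Proof.
move=> fg dfx; have fx := ex_diff (is_diff_def := dfx).
have fgx : f x = g x by exact: nbhs_singleton fg.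
have go : g \o shift x = cst (g x) + 'd f x +o_ 0 id.
  apply/eqaddoP => _/posnumP[e].
  have /eqaddoP/(_ e%:num (gt0 e)) := diff_locally fx.
  move: fg; rewrite (near_shift 0) subr0; apply: filterS2 => y /= fgy.
  by rewrite !fctE /= fgy fgx.
have dg : 'd g x = 'd f x :> (V -> W).
  by apply: diff_unique => //; exact: diff_continuous.
split; last by rewrite dg; exact: diff_val.
by apply/diff_locallyP; rewrite dg; split => //; exact: diff_continuous.
Qed.

Lemma is_diff_clin (A : clin V W) x : is_diff x A A.
Proof.
have cA : continuous A by exact: clin_continuous.
by split; [exact: linear_differentiable|exact: diff_lin].
Qed.
End LocalDiff.

Section BilinDiff.
Context {R : realType} {E F G W : normedModType R} (b : clin F (clin G W)).

Let bf (x : F) (y : G) : W := b x y.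

Let bf_bilinear : bilinear_for *:%R *:%R bf.
Proof.
split => [u|u] a x y; rewrite /bf.
  by rewrite linearP.
by rewrite linearP.
Qed.

HB.instance Definition _ := bilinear_isBilinear.Build R F G W _ _ bf bf_bilinear.

Lemma is_diff_bilin (f df : E -> F) (g dg : E -> G) x :
  is_diff x f df -> is_diff x g dg ->
  is_diff x (fun u => b (f u) (g u)) (fun v => b (df v) (g x) + b (f x) (dg v)).
Proof.
move=> dfx dgx.
have cb : continuous (fun p : F * G => bf p.1 p.2).
  move=> p; apply: clin_app_cvg; last exact: cvg_snd.
  by apply: (@cvg_comp _ _ _ fst b (nbhs p) _ _ cvg_fst); exact: clin_continuous.
have db : is_diff (f x, g x) (fun q : F * G => bf q.1 q.2)
    (fun q => bf (f x) q.2 + bf q.1 (g x)).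
  by split; [exact: differentiable_bilin|rewrite diff_bilin].
have D := @is_diff_comp _ _ _ _ _ _ _ _ x (is_diff_pair dfx dgx) db.
by apply: (is_diff_eq D); apply/funext => v /=; rewrite addrC.
Qed.
End BilinDiff.

Section CnCalculus.
Context {R : realType}.

Lemma CnS (V : normedModType R) n :
    forall (W : normedModType R) (U : set V) (f : V -> W),
  Cn n.+1 U f -> Cn n U f.
Proof.
elim: n => [|n IHn] W U f [df [dfU Cdf]].
  by move=> x Ux; have := dfU x Ux => d; apply: differentiable_continuous; case: d.
by exists df; split => //; exact: IHn Cdf.
Qed.

Lemma Cn_eq (V W : normedModType R) n (U : set V) (f g : V -> W) :
  open U -> (forall x, U x -> f x = g x) -> Cn n U f -> Cn n U g.
Proof.
move=> oU fg; have fgn x : U x -> \forall y \near x, f y = g y.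
  by move=> Ux; apply: filterS (open_nbhs_nbhs (conj oU Ux)).
case: n => [Cf x Ux|n [df [dfU Cdf]]].
  have fx : f @ x --> f x := Cf x Ux.
  suff gx : g @ x --> g x by [].
  rewrite -(fg x Ux); apply: cvg_trans fx; apply: near_eq_cvg.
  by apply: filterS (fgn x Ux).
by exists df; split => // x Ux; apply: near_eq_is_diff (dfU x Ux); exact: fgn.
Qed.

Lemma CnD (V : normedModType R) n :
    forall (W : normedModType R) (U : set V) (f g : V -> W),
  Cn n U f -> Cn n U g -> Cn n U (fun u => f u + g u).
Proof.
elim: n => [|n IHn] W U f g.
  by move=> Cf Cg x Ux; apply: cvgD; [exact: Cf|exact: Cg].
move=> [df [dfU Cdf]] [dg [dgU Cdg]].
exists (fun u => df u + dg u); split; last exact: IHn.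
by move=> x Ux; apply: (@is_diffD _ _ _ f g); [exact: dfU|exact: dgU].
Qed.

(** The derivative of b(f, g) is b(df, g) + b(f, dg), a sum of two expressions of
    the same kind for the bilinear maps b1 and b2 that b induces on operators; the
    induction on n therefore has to range over all b and all target spaces. *)
Lemma Cn_bilin (V : normedModType R) n : forall (F G W : normedModType R)
    (b : clin F (clin G W)) (U : set V) (f : V -> F) (g : V -> G),
  Cn n U f -> Cn n U g -> Cn n U (fun u => b (f u) (g u)).
Proof.
elim: n => [|n IHn] F G W b U f g.
  move=> Cf Cg x Ux; apply: clin_app_cvg; last exact: Cg.
  by apply: (@cvg_comp _ _ _ f b (nbhs x) _ _ (Cf x Ux)); exact: clin_continuous.
move=> Cf Cg; have [df [dfU Cdf]] := Cf; have [dg [dgU Cdg]] := Cg.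
pose b1 : clin (clin V F) (clin G (clin V W)) :=
  clin_flip (clin_comp clin_compb (clin_flip b)).
pose b2 : clin F (clin (clin V G) (clin V W)) := clin_comp clin_compb b.
exists (fun u => b1 (df u) (g u) + b2 (f u) (dg u)); split.
  by move=> x Ux; exact: is_diff_bilin (dfU x Ux) (dgU x Ux).
by apply: CnD; [apply: IHn => //; exact: CnS|apply: IHn => //; exact: CnS].
Qed.

Lemma Cn_cst (V : normedModType R) n :
    forall (W : normedModType R) (U : set V) (a : W),
  Cn n U (fun _ : V => a).
Proof.
elim: n => [|n IHn] W U a; first by move=> x _; exact: cvg_cst.
by exists (fun _ => 0); split; [move=> x _; exact: is_diff_cst|exact: IHn].
Qed.

Lemma Cn_clin (V W : normedModType R) n (U : set V) (A : clin V W) : Cn n U A.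
Proof.
case: n => [|n]; first by move=> x _; exact: clin_continuous.
exists (fun=> A); split; last exact: Cn_cst.
by move=> x _; exact: is_diff_clin.
Qed.

Lemma Cn_lin (V W Z : normedModType R) n (A : clin W Z) (U : set V) (f : V -> W) :
  Cn n U f -> Cn n U (A \o f).
Proof.
move=> Cf; exact: (@Cn_bilin _ _ _ _ _ (clin_id _) _ (fun=> A) f (Cn_cst _ _ _) Cf).
Qed.

(** With a linear inner map the derivative of the composite is df at L x preceded
    by a fixed operator: a fixed linear function of df, so that the induction
    closes without the C^n chain rule for nonlinear maps. *)
Lemma Cn_precomp (V V' : normedModType R) (L : clin V' V) n :
  forall (W : normedModType R) (U : set V) (U' : set V') (f : V -> W),
  (forall x, U' x -> U (L x)) -> Cn n U f -> Cn n U' (f \o L).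
Proof.
elim: n => [|n IHn] W U U' f sU.
  move=> Cf x Ux; apply: continuous_comp; first exact: clin_continuous.
  exact: Cf (sU _ Ux).
move=> [df [dfU Cdf]]; exists (clin_flip clin_compb L \o (df \o L)); split.
  by move=> x Ux; apply: is_diff_comp (is_diff_clin L x) (dfU _ (sU _ Ux)).
by apply: Cn_lin; exact: IHn Cdf.
Qed.

Lemma smooth_diff (V W : normedModType R) (U : set V) (f : V -> W) :
  smooth_on U f -> forall x, U x -> differentiable f x.
Proof. by move=> /(_ 1%N)[df [+ _]] x Ux => /(_ x Ux); case. Qed.

End CnCalculus.

(** Each order of differentiability comes with its own derivative; on an open set
    they all agree, as the differential is unique, so that one of them serves for
    all orders. *)
Lemma smooth_derivative (R : realType) (V W : normedModType R) (U : set V)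
    (f : V -> W) :
  open U -> smooth_on U f ->
  exists df : V -> clin V W, (forall x, U x -> is_diff x f (df x)) /\ smooth_on U df.
Proof.
move=> oU sf; have [df [dfU _]] := sf 1%N.
exists df; split => // n; have [df' [dfU' Cdf']] := sf n.+1.
apply: Cn_eq Cdf' => // x Ux; apply: clinP => v.
have [_ <-] := dfU x Ux; by have [_ <-] := dfU' x Ux.
Qed.

Lemma is_diff_quotient_cvg (R : realType) (V W : normedModType R)
    (f df : V -> W) x v :
  is_diff x f df ->
  (fun h : R => h^-1 *: (f (x + h *: v) - f x)) @ 0^' --> df v.
Proof.
move=> [fx <-]; have fv := diff_derivable (v := v) fx; rewrite -deriveE//.
have -> : (fun h : R => h^-1 *: (f (x + h *: v) - f x)) =
    (fun h => h^-1 *: ((f \o shift x) (h *: v) - f x)).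
  by apply/funext => h /=; rewrite [h *: v + x]addrC.
exact: fv.
Qed.

(** * Smooth maps into projective limits *)

Section SubproductTopology.
Context {R : realType} {V : nat -> normedModType R} {S : lsubprod V}.

Lemma initial_cvg (T : choiceType) (T' : topologicalType) (f : T -> T')
    (F : set_system T) (s : T) : Filter F ->
  f @ F --> f s -> F --> (s : initial_topology f).
Proof.
move=> FF fF A [_ [[B oB <-] Bs] sBA].
by apply: filterS sBA _; apply: fF; exact: open_nbhs_nbhs.
Qed.

Lemma lsp_cvg (F : set_system (lsp S)) (x : lsp S) : Filter F ->
  (forall i, (fun y : lsp S => y i) @ F --> x i) -> F --> x.
Proof.
move=> FF Fx; apply: (@initial_cvg _ _ (@lsp_val R V S : lsp S -> prod_topology V)).
apply/cvg_sup => i.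
apply: (@initial_cvg (prod_topology V) _ (fun f : (forall i, V i) => f i)).
exact: (Fx i).
Qed.

Lemma lsp_proj_continuous i : continuous (fun x : lsp S => x i).
Proof.
move=> x.
apply: (@cvg_comp _ _ _ (@lsp_val R V S : lsp S -> prod_topology V)
  (@proj nat V i) (nbhs x) (nbhs (lsp_val x : prod_topology V))).
  exact: initial_continuous.
exact: proj_continuous.
Qed.

Lemma lsp_line_continuous (x v : lsp S) : (fun h : R => x + h *: v) @ 0 --> x.
Proof.
apply: lsp_cvg => [|i /=]; first exact: fmap_filter.
suff H : (fun h : R => x i + h *: v i) @ 0 --> x i + 0 *: v i.
  by move: H; rewrite scale0r addr0.
apply: cvgD; first exact: cvg_cst.
by apply: cvgZr_tmp; exact: cvg_id.
Qed.

End SubproductTopology.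

Section SmoothLimit.
Context {R : realType} {L : nat -> normedModType R} {S : lsubprod L}.

(* Closedness of the subspace, for the limits of difference quotients. *)
Hypothesis S_closed : forall (g : R -> lsp S) (b : forall i, L i),
  (forall i, (fun h => g h i) @ 0^' --> b i) -> lsp_set S b.

(** The derivative of f at (x, v) has the components df_i(p_i x).(p_i v), which
    are C^(n-1) in (p_i x, p_i v). It is thus again a limit of maps between normed
    spaces, but over V * V and with the spaces E i * E i; hence the statement is for
    an arbitrary V with projections p rather than for a limit space. Since the
    operations of V need not be continuous, the stability of U along lines is a
    hypothesis. *)
Lemma limit_Cn_dir n : forall (V : preTopologicalLmodType R)
    (E : nat -> normedModType R) (p : forall i, V -> E i) (U : set V)
    (U_ : forall i, set (E i)) (f : V -> lsp S) (f_ : forall i, E i -> L i),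
  open U -> (forall i, continuous (p i)) ->
  (forall i x v h, p i (x + h *: v) = p i x + h *: p i v) ->
  (forall x v, U x -> \forall h \near (0 : R), U (x + h *: v)) ->
  (forall i x, U x -> U_ i (p i x)) ->
  (forall i, Cn n (U_ i) (f_ i)) ->
  (forall x, U x -> forall i, f x i = f_ i (p i x)) -> Cn_dir n U f.
Proof.
elim: n => [|n IHn] V E p U U_ f f_ oU cp pl lineU pU Cf fE.
  move=> x Ux; suff : f @ x --> f x by [].
  apply: lsp_cvg => i; rewrite (fE x Ux).
  have fpx : (f_ i \o p i) @ x --> (f_ i \o p i) x.
    have px : p i @ x --> p i x := cp i x.
    have fx : f_ i @ (p i x) --> f_ i (p i x) := Cf i _ (pU _ _ Ux).
    exact: cvg_comp px fx.
  suff : (fun y => f y i) @ x --> f_ i (p i x) by [].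
  apply: cvg_trans fpx; apply: near_eq_cvg.
  by apply: filterS (open_nbhs_nbhs (conj oU Ux)) => y Uy /=; rewrite fE.
have [df_ df_P] : exists df_ : forall i, E i -> clin (E i) (L i), forall i,
    (forall x, U_ i x -> is_diff x (f_ i) (df_ i x)) /\ Cn n (U_ i) (df_ i).
  exists (fun i => sval (cid (Cf i))) => i.
  exact: svalP (cid (Cf i)).
have quot x v : U x -> forall i,
    (fun h : R => (h^-1 *: (f (x + h *: v) - f x)) i) @ 0^' -->
    df_ i (p i x) (p i v).
  move=> Ux i.
  have H := is_diff_quotient_cvg (v := p i v) ((df_P i).1 _ (pU i x Ux)).
  apply: cvg_trans H.
  apply: near_eq_cvg; apply: nbhs_dnbhs; apply: filterS (lineU x v Ux) => h Uh.
  by rewrite /= !fE// pl.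
pose df (xv : V * V) : lsp S :=
  match pselect (U xv.1) with
  | left Ux => Lsp (S_closed (quot _ xv.2 Ux))
  | right _ => 0
  end.
have dfE xv : U xv.1 -> forall i, df xv i = df_ i (p i xv.1) (p i xv.2).
  by move=> Ux i; rewrite /df; case: pselect.
exists df; split.
  move=> x v Ux; apply: lsp_cvg => i.
  rewrite (dfE (x, v))//; exact: (quot x v Ux i).
apply: (IHn (V * V)%type (fun i => (E i * E i)%type)
  (fun i xv => (p i xv.1, p i xv.2)) _
  (fun i => U_ i `*` setT) df (fun i uv => df_ i uv.1 uv.2)).
- rewrite openE => -[x v] [/= Ux _]; exists (U, setT) => //=.
  by split; [exact: open_nbhs_nbhs|exact: filterT].
- move=> i x; apply: cvg_pair.
    by apply: (@cvg_comp _ _ _ fst (p i) (nbhs x) _ _ cvg_fst); exact: cp.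
  by apply: (@cvg_comp _ _ _ snd (p i) (nbhs x) _ _ cvg_snd); exact: cp.
- by move=> i x v h /=; rewrite !pl.
- move=> x v [Ux _]; by apply: filterS (lineU x.1 v.1 Ux).
- by move=> i x [Ux _]; split => //; exact: pU.
- move=> i; apply: (@Cn_bilin _ _ _ _ _ _ (clin_id _)).
    apply: (@Cn_precomp _ _ _ clin_fst _ _ (U_ i)); last exact: (df_P i).2.
    by move=> x [].
  exact: Cn_clin clin_snd.
- by move=> x [Ux _] i; exact: dfE.
Qed.

End SmoothLimit.

(** * Derivatives along vector fields on a Banach manifold *)

Section ChartNbhs.
Context {R : realType} {T : topologicalType} {E : normedModType R} (c : chart T E).

Lemma ch_imgP p : ch_dom c p -> ch_img c (c p).
Proof. by move=> cp; exists p. Qed.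

Lemma ch_invK u : ch_img c u -> c (ch_inv c u) = u.
Proof. by move=> [p cp <-]; rewrite ch_mapK. Qed.

Lemma ch_inv_dom u : ch_img c u -> ch_dom c (ch_inv c u).
Proof. by move=> [p cp <-]; rewrite ch_mapK. Qed.

Lemma near_ch_img u : ch_img c u -> \forall w \near u, ch_img c w.
Proof.
by move=> cu; apply: open_nbhs_nbhs; split => //; exact: ch_img_open.
Qed.

Lemma near_ch_inv (A : set T) p : ch_dom c p -> nbhs p A ->
  \forall w \near c p, A (ch_inv c w).
Proof.
move=> cp pA; have := @ch_inv_continuous _ _ _ c _ (ch_imgP cp).
by move=> /(_ A); rewrite ch_mapK// => /(_ pA).
Qed.
End ChartNbhs.

Section TangentDerivative.
Context {R : realType}.

(** Chain rule for f = f' \o F, in charts c and d. It is used twice: with F a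
    connecting map it gives the compatibility of derivatives along a thread, and
    with F the identity their independence of the chart. *)
Lemma diff_tangent_image (E E' : completeNormedModType R) (N : bmanifold E)
    (N' : bmanifold E') (F : N -> N') (p : N) (q : N') (v : tangent p)
    (w : tangent q) (f : N -> R) (f' : N' -> R) c d :
  smooth_map F -> smooth_fun f' -> (forall x, f x = f' (F x)) ->
  is_tangent_image F v w -> atlas c -> atlas d -> ch_dom c p -> ch_dom d q ->
  'd (f \o ch_inv c : E -> R^o) (c p) (tv v c) =
  'd (f' \o ch_inv d : E' -> R^o) (d q) (tv w d).
Proof.
move=> [cF sF] sf' ff' [Fpq vw] ac ad cp dq.
rewrite (vw c d ac ad cp dq).
have dFp : ch_dom d (F p) by rewrite Fpq.
have dG : differentiable (d \o F \o ch_inv c) (c p).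
  by apply: smooth_diff (sF c d ac ad) _ _; exists p.
have Gp : (d \o F \o ch_inv c) (c p) = d q by rewrite /= ch_mapK// Fpq.
have df' : differentiable (f' \o ch_inv d : E' -> R^o) ((d \o F \o ch_inv c) (c p)).
  rewrite Gp; apply: smooth_diff (sf' d ad) _ _; exact: ch_imgP.
have D := is_diff_comp (differentiableP dG) (differentiableP df').
have /near_eq_is_diff/(_ D)[_ ->] : \forall u \near c p,
    ((f' \o ch_inv d) \o (d \o F \o ch_inv c)) u = (f \o ch_inv c) u.
  have dF : nbhs p (F @^-1` ch_dom d).
    by apply: cF; apply: open_nbhs_nbhs; split => //; exact: ch_dom_open.
  by apply: filterS (near_ch_inv cp dF) => u /= du; rewrite ch_mapK// ff'.
by rewrite /= ch_mapK// Fpq.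
Qed.

Context {E : completeNormedModType R} {N : bmanifold E}.

Lemma smooth_map_id : smooth_map (@id N).
Proof.
split; first by move=> x; exact: cvg_id.
by move=> c d ac ad; have [] := atlas_compat ac ad.
Qed.

Lemma tangent_image_id (p : N) (v : tangent p) : is_tangent_image (@id N) v v.
Proof. by split => // c d ac ad cp dp; exact: tv_change. Qed.

Definition tderiv (f : N -> R) (p : N) (v : tangent p) : R :=
  let c := s2val (cid2 (atlas_cover p)) in
  'd (f \o ch_inv c : E -> R^o) (c p) (tv v c).

Definition vf_deriv (X : vfield N) (f : N -> R) : N -> R := fun p => tderiv f (X p).

Lemma tderivE (f : N -> R) (p : N) (v : tangent p) c :
  smooth_fun f -> atlas c -> ch_dom c p ->
  tderiv f v = 'd (f \o ch_inv c : E -> R^o) (c p) (tv v c).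
Proof.
move=> sf ac cp; rewrite /tderiv; case: cid2 => d ad dp /=.
exact: (diff_tangent_image smooth_map_id sf _ (tangent_image_id v)).
Qed.

Lemma vf_derivE (X : vfield N) (f : N -> R) c (DF : E -> clin E R^o) u :
  smooth_fun f -> atlas c -> ch_img c u ->
  is_diff u (f \o ch_inv c : E -> R^o) (DF u) ->
  vf_deriv X f (ch_inv c u) = DF u (vf_rep c X u).
Proof.
move=> sf ac cu [_ <-]; rewrite /vf_deriv (tderivE _ sf ac (ch_inv_dom cu)).
by rewrite ch_invK.
Qed.

Lemma smooth_vf_deriv (X : vfield N) (f : N -> R) :
  smooth_vfield X -> smooth_fun f -> smooth_fun (vf_deriv X f).
Proof.
move=> sX sf c ac n.
have [DF [dF sDF]] := smooth_derivative (@ch_img_open _ _ _ c) (sf c ac).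
apply: (@Cn_eq _ _ _ _ _ (fun u => DF u (vf_rep c X u))).
- exact: ch_img_open.
- by move=> u cu; rewrite /= (vf_derivE _ sf ac cu (dF u cu)).
(* The identity of L(E, R), read as a bilinear map, is the evaluation pairing. *)
- by apply: (@Cn_bilin _ _ _ _ _ _ (clin_id _)); [exact: sDF|exact: sX].
Qed.

(** By the product rule, X(Y f) is D^2 f(X, Y) + Df.(DY.X), and the second term is
    also the leading term of (nabla_X Y) f. *)
Lemma vf_deriv_commutator (nabla : vfield N -> vfield N -> vfield N)
    (X Y : vfield N) (f : N -> R) c Gamma (DF : E -> clin E R^o)
    (D2F : E -> clin E (clin E R^o)) u :
  smooth_vfield X -> smooth_vfield Y -> smooth_fun f ->
  atlas c -> conn_component nabla c Gamma -> ch_img c u ->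
  (forall w, ch_img c w -> is_diff w (f \o ch_inv c : E -> R^o) (DF w)) ->
  is_diff u DF (D2F u) ->
  vf_deriv X (vf_deriv Y f) (ch_inv c u) - vf_deriv (nabla X Y) f (ch_inv c u) =
  D2F u (vf_rep c X u) (vf_rep c Y u) +
  DF u (Gamma u (vf_rep c X u) (vf_rep c Y u)).
Proof.
move=> sX sY sf ac [_ Gammac] cu dF d2F.
have dY : is_diff u (vf_rep c Y) ('d (vf_rep c Y) u).
  by apply: differentiableP; exact: smooth_diff (sY c ac) _ cu.
have dYf := is_diff_bilin (clin_id (clin E R^o)) d2F dY.
have dYf' : is_diff u (vf_deriv Y f \o ch_inv c : E -> R^o)
    (fun v => D2F u v (vf_rep c Y u) + DF u ('d (vf_rep c Y) u v)).
  apply: near_eq_is_diff dYf.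
  apply: filterS (near_ch_img cu) => w cw /=.
  by rewrite (vf_derivE _ sf ac cw (dF w cw)).
rewrite (vf_derivE _ sf ac cu (dF u cu)) Gammac//.
rewrite /vf_deriv (tderivE _ (smooth_vf_deriv sY sf) ac (ch_inv_dom cu)) ch_invK//.
have [_ ->] := dYf'.
by rewrite linearB /= opprB addrACA subrr addr0.
Qed.

End TangentDerivative.

(** * Derivatives on the projective limit *)

Section LimitCalculus.
Context {R : realType} {B : bansys R} {M : plmanifold B}.
Implicit Types (c : pchart M) (u v : flim B).

Lemma pc_imgP c (m : mlim M) : pc_dom c m -> pc_img c (pc_map c m).
Proof. by move=> cm; exists m. Qed.

Lemma pc_inv_dom c u : pc_img c u -> pc_dom c (pc_inv c u).
Proof. by move=> [m cm <-]; rewrite pc_mapK. Qed.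

Lemma pc_img_ch_img c u i : pc_img c u -> ch_img (c i) (u i).
Proof. by move=> [m cm <-]; rewrite pc_mapE//; exists (m i). Qed.

Lemma pc_invE c u i : pc_img c u -> pc_inv c u i = ch_inv (c i) (u i).
Proof.
by move=> [m cm <-]; rewrite pc_mapK// pc_mapE// ch_mapK//; exact: cm.
Qed.

Lemma pc_coordE c (m : mlim M) (v : ltangent m) i :
  pc_dom c m -> pc_coord c v i = tv (v i) (c i).
Proof. by move=> cm; rewrite /pc_coord; case: pselect. Qed.

Lemma near_pc_line c u v : pc_img c u ->
  \forall h \near (0 : R), pc_img c (u + h *: v).
Proof.
move=> cu; have /(_ (pc_img c)) := @lsp_line_continuous _ _ _ u v; apply.
by apply: open_nbhs_nbhs; split => //; exact: pc_img_open.
Qed.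

(** The line through u in the direction v stays in the image of the chart for
    small parameters, where g only sees its i-th coordinate. *)
Lemma ddir_cylinder c (g : flim B -> R) i (G dG : B i -> R^o) u v : pc_img c u ->
  (forall w, pc_img c w -> g w = G (w i)) -> is_diff (u i) G dG ->
  ddir g u v = dG (v i).
Proof.
move=> cu gG dGu; apply: cvg_lim => //.
have H := is_diff_quotient_cvg (v := v i) dGu.
apply: cvg_trans H; apply: near_eq_cvg; apply: nbhs_dnbhs.
by apply: filterS (near_pc_line v cu) => h ch; rewrite !gG.
Qed.

Lemma lieE (f : mlim M -> R) (f_ : forall i, M i -> R) (X : lvfield M)
    (X_ : forall i, vfield (M i)) m i :
  fun_thread f_ -> is_fun_lim f f_ -> is_vf_lim X X_ ->
  lie X f m = vf_deriv (X_ i) (f_ i) (m i).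
Proof.
move=> [sf _] ff_ XX_; rewrite /lie.
have cm : pc_dom (chart_at m) m by exact: (projT2 (cid (pl_cover m))).
set c := chart_at m in cm *; have ac := pc_atlas c i.
have ci := pc_img_ch_img i (pc_imgP cm).
have dF := differentiableP (smooth_diff (sf i _ ac) ci).
have fE w : pc_img c w -> (f \o pc_inv c) w = (f_ i \o ch_inv (c i)) (w i).
  by move=> cw /=; rewrite (ff_ _ i) pc_invE.
rewrite (ddir_cylinder _ (pc_imgP cm) fE dF) pc_coordE// pc_mapE// XX_.
by rewrite /vf_deriv (tderivE _ (sf i) ac (cm i)).
Qed.

Lemma vf_deriv_thread (f_ : forall i, M i -> R) (X_ : forall i, vfield (M i)) :
  fun_thread f_ -> vf_thread X_ -> fun_thread (fun i => vf_deriv (X_ i) (f_ i)).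
Proof.
move=> [sf cf] [sX cX]; split => [i|i j h p]; first exact: smooth_vf_deriv.
rewrite /vf_deriv.
have [d ad dp] := atlas_cover (phi h p); have [c ac cp] := atlas_cover p.
rewrite (tderivE _ (sf i) ad dp) (tderivE _ (sf j) ac cp).
exact: (diff_tangent_image (phi_smooth M h) (sf i) (cf i j h) (cX i j h p)).
Qed.

Lemma FM_lie f (X : lvfield M) : FM f -> GM X -> FM (lie X f).
Proof.
move=> [f_ tf ff_] [X_ tX XX_].
exists (fun i => vf_deriv (X_ i) (f_ i)); first exact: vf_deriv_thread.
by move=> m i; exact: lieE.
Qed.

Lemma FM_sub (f g : mlim M -> R) : FM f -> FM g -> FM (fun m => f m - g m).
Proof.
move=> [f_ [sf cf] ff_] [g_ [sg cg] gg_].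
exists (fun i p => f_ i p - g_ i p); last by move=> m i; rewrite (ff_ m i) (gg_ m i).
split=> [i c ac n|i j h p]; last by rewrite (cf i j h) (cg i j h).
apply: (CnD (f := f_ i \o ch_inv c : _ -> R^o)); first exact: sf.
apply: (@Cn_eq _ _ _ _ _ (- clin_id R^o \o (g_ i \o ch_inv c : _ -> R^o))) => //.
  exact: ch_img_open.
by apply: Cn_lin; exact: sg.
Qed.

End LimitCalculus.

(** * The Hessian of a connection *)

Section HessianComponents.
Context {R : realType} {B : bansys R} {M : plmanifold B}.

(** The conditions that define H^2(F, F) are equalities between values of the
    components, and evaluation is continuous. *)
Lemma hlim_closed (g : R -> hlim B) (b : forall i, bilin (B i) (B i)) :
  (forall i, (fun h => g h i) @ 0^' --> b i) -> lsp_set (hlim_lsub B) b.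
Proof.
move=> gb i j h x y.
have app k (x' y' : B k) : (fun t => g t k x' y') @ 0^' --> b k x' y'.
  apply: clin_app_cvg; last exact: cvg_cst.
  by apply: clin_app_cvg; [exact: gb|exact: cvg_cst].
have lim_l := app i (rho B h x) (rho B h y).
have lim_r : (fun t => rho B h (g t j x y)) @ 0^' --> rho B h (b j x y).
  apply: (@cvg_comp _ _ _ (fun t => g t j x y) (rho B h) _ _ _ (app j x y)).
  exact: clin_continuous.
apply: (cvg_unique (@norm_hausdorff _ (B i)) lim_l).
suff -> : (fun t => g t i (rho B h x) (rho B h y)) =
  (fun t => rho B h (g t j x y)) by [].
by apply/funext => t; rewrite (lsp_valP (g t)).
Qed.

Variables (c : pchart M) (Gamma_ : forall i, B i -> bilin (B i) (B i)).
Hypothesis tGamma : gamma_thread c Gamma_.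

Lemma gamma_lim_subproof (u : flim B) : pc_img c u ->
  lsp_set (hlim_lsub B) (fun i => Gamma_ (u i)).
Proof.
move=> cu i j h x y.
by rewrite (tGamma h (pc_img_ch_img j cu)) (lsp_valP u).
Qed.

Definition gamma_lim (u : flim B) : hlim B :=
  match pselect (pc_img c u) with
  | left cu => Lsp (gamma_lim_subproof cu)
  | right _ => 0
  end.

Lemma gamma_limE u i : pc_img c u -> gamma_lim u i = Gamma_ (u i).
Proof. by move=> cu; rewrite /gamma_lim; case: pselect. Qed.

Lemma smooth_gamma_lim : (forall i, smooth_on (ch_img (c i)) (@Gamma_ i)) ->
  smooth_dir_on (pc_img c) gamma_lim.
Proof.
move=> sGamma n.
apply: (limit_Cn_dir hlim_closed (p := fun i (u : flim B) => u i)
  (U_ := fun i => ch_img (c i)) (f_ := Gamma_)) => //.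
- exact: pc_img_open.
- by move=> i; exact: lsp_proj_continuous.
- by move=> u v cu; exact: near_pc_line.
- by move=> i u cu; exact: pc_img_ch_img.
- by move=> i; exact: sGamma.
- by move=> u cu i; exact: gamma_limE.
Qed.

End HessianComponents.

Section HessianOfConnection.
Context {R : realType} {B : bansys R} {M : plmanifold B}.
Variable nabla_ : forall i, vfield (M i) -> vfield (M i) -> vfield (M i).
Variable nabla : lvfield M -> lvfield M -> lvfield M.
Hypothesis hnabla_ : conn_system nabla_.
Hypothesis hnabla : is_conn_lim nabla nabla_.

Definition conn_hessian (f : mlim M -> R) (X Y : lvfield M) : mlim M -> R :=
  fun m => lie X (lie Y f) m - lie (nabla X Y) f m.

Lemma FM_conn_hessian f X Y : FM f -> GM X -> GM Y -> FM (conn_hessian f X Y).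
Proof.
move=> Ff GX GY; apply: FM_sub; first by apply: FM_lie => //; exact: FM_lie.
by apply: FM_lie => //; exact: hnabla.1.
Qed.

(** All the functions involved are threads, so that their values at a point of the
    limit can be computed on any single M i. *)
Lemma conn_hessianE (c : pchart M) i (Gamma : B i -> bilin (B i) (B i))
    (f_ : forall i, M i -> R) (DF : B i -> clin (B i) R^o)
    (D2F : B i -> clin (B i) (clin (B i) R^o)) f X Y u :
  conn_component (@nabla_ i) (c i) Gamma ->
  fun_thread f_ -> is_fun_lim f f_ -> GM X -> GM Y -> pc_img c u ->
  (forall w, ch_img (c i) w ->
    is_diff w (f_ i \o ch_inv (c i) : B i -> R^o) (DF w) /\ is_diff w DF (D2F w)) ->
  conn_hessian f X Y (pc_inv c u) =
  D2F (u i) (pc_rep c X u i) (pc_rep c Y u i) +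
  DF (u i) (Gamma (u i) (pc_rep c X u i) (pc_rep c Y u i)).
Proof.
move=> Gc tf ff_ [X_ tX XX_] [Y_ tY YY_] cu dF.
have ci := pc_img_ch_img i cu; have cm := pc_inv_dom cu.
have repE Z Z_ : is_vf_lim Z Z_ -> pc_rep c Z u i = vf_rep (c i) (Z_ i) (u i).
  by move=> ZZ_; rewrite /pc_rep pc_coordE// ZZ_ /vf_rep pc_invE.
rewrite (repE _ _ XX_) (repE _ _ YY_) /conn_hessian.
have tYf := vf_deriv_thread tf tY.
have lYf : is_fun_lim (lie Y f) (fun i => vf_deriv (Y_ i) (f_ i)).
  by move=> m k; exact: lieE.
rewrite (@lieE _ _ _ _ _ _ _ _ i tYf lYf XX_).
rewrite (@lieE _ _ _ _ _ _ _ _ i tf ff_ (hnabla.2 _ _ _ _ tX XX_ tY YY_)).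
rewrite pc_invE//.
apply: vf_deriv_commutator => //.
- exact: (tX.1 i).
- exact: (tY.1 i).
- exact: (tf.1 i).
- exact: pc_atlas.
- by move=> w /dF[].
- by have [] := dF _ ci.
Qed.

Lemma local_derivatives (c : pchart M) i (f_ : forall i, M i -> R) : fun_thread f_ ->
  exists (DF : B i -> clin (B i) R^o) (D2F : B i -> clin (B i) (clin (B i) R^o)),
  forall w, ch_img (c i) w ->
    is_diff w (f_ i \o ch_inv (c i) : B i -> R^o) (DF w) /\ is_diff w DF (D2F w).
Proof.
move=> [sf _]; have oc := @ch_img_open _ _ _ (c i).
have [DF [dF sDF]] := smooth_derivative oc (sf i _ (pc_atlas c i)).
have [D2F [d2F _]] := smooth_derivative oc sDF.
by exists DF, D2F => w cw; split; [exact: dF|exact: d2F].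
Qed.

(** Bilinearity over F(M) is pointwise: in a chart at m the local formula depends
    bilinearly on the coordinates of the two fields at m. *)
Lemma is_tensor2_conn_hessian f : FM f -> is_tensor2 (conn_hessian f).
Proof.
move=> Ff; split=> [X Y GX GY|a b X Y Z W _ _ GX GY GZ GW ZXY m].
  exact: FM_conn_hessian.
have cm : pc_dom (chart_at m) m by exact: (projT2 (cid (pl_cover m))).
move: (chart_at m) cm => c cm.
have [Gamma_ [cGamma tGamma]] := hnabla_.2 c.
have [f_ tf ff_] := Ff.
have [DF [D2F dF]] := local_derivatives c 0 tf.
have E X' Y' GX' GY' := @conn_hessianE c 0 _ _ _ _ _ X' Y' _ (cGamma 0%N)
  tf ff_ GX' GY' (pc_imgP cm) dF.
rewrite pc_mapK// in E.
have ZE : pc_rep c Z (pc_map c m) 0 = a m *: pc_rep c X (pc_map c m) 0 +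
    b m *: pc_rep c Y (pc_map c m) 0.
  by rewrite /pc_rep pc_mapK// !pc_coordE// ZXY.
rewrite !E// ZE.
have comb (V U : normedModType R) (A : clin V U) s t x y :
    A (s *: x + t *: y) = s *: A x + t *: A y by rewrite linearD !linearZ.
by split; rewrite !comb ?(clinDE, clinZE) ?comb !mulrDr; exact: addrACA.
Qed.

Lemma is_hessian_conn_hessian : is_hessian conn_hessian.
Proof.
split=> [f|c]; first exact: is_tensor2_conn_hessian.
have [Gamma_ [cGamma tGamma]] := hnabla_.2 c.
exists Gamma_, (gamma_lim tGamma); split => //.
- by move=> i; have [] := cGamma i.
- by move=> u cu i; exact: gamma_limE.
- by apply: smooth_gamma_lim => i; have [] := cGamma i.
move=> f X Y [f_ tf ff_] GX GY u cu.
have [DF [D2F dF]] := local_derivatives c 0 tf.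
rewrite (conn_hessianE (cGamma 0%N) tf ff_ GX GY cu dF).
have c0 := pc_img_ch_img 0 cu; have [dF0 d2F0] := dF _ c0.
have fE w : pc_img c w -> (f \o pc_inv c) w = (f_ 0%N \o ch_inv (c 0%N)) (w 0%N).
  by move=> cw /=; rewrite (ff_ _ 0%N) pc_invE.
rewrite (ddir_cylinder _ cu fE dF0) /= gamma_limE//; congr (_ + _).
(* The second direction is frozen in the second derivative of f. *)
have dY := is_diff_bilin (clin_id (clin (B 0%N) R^o)) d2F0
  (is_diff_cst (pc_rep c Y u 0%N) (u 0%N)).
rewrite /ddir2 (ddir_cylinder _ cu _ dY) /=.
  by rewrite linear0 addr0.
by move=> w cw; rewrite (ddir_cylinder _ cw fE (dF _ (pc_img_ch_img 0 cw)).1).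
Qed.

End HessianOfConnection.

Theorem theorem3p5 (R : realType) (B : bansys R) (M : plmanifold B)
    (nabla_ : forall i, vfield (M i) -> vfield (M i) -> vfield (M i))
    (nabla : lvfield M -> lvfield M -> lvfield M)
    (hnabla_ : conn_system nabla_) (hnabla : is_conn_lim nabla nabla_) :
  is_hessian (fun f X Y m => lie X (lie Y f) m - lie (nabla X Y) f m) /\
  exists H : (mlim M -> R) -> lvfield M -> lvfield M -> mlim M -> R,
    is_hessian H /\
    forall f X Y, FM f -> GM X -> GM Y -> forall m,
      lie (nabla X Y) f m = lie X (lie Y f) m - H f X Y m.
Proof.
have hH := is_hessian_conn_hessian hnabla_ hnabla.
split; first exact: hH.
exists (conn_hessian nabla); split=> // f X Y _ _ _ m.
by rewrite /conn_hessian opprB addrC subrK.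
Qed.
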